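(* Suppose $k\ge 3$ and $n\ge 2$. If $S$ is an $\mathcal{NAS}_k(n)$ of period $m$ then $$ m\le \begin{cases} \dfrac{k^n-1}{2} & \text{if } k \text{ is odd},\\[2mm] \dfrac{k^n-2^n}{2} & \text{if } k \text{ is even}. \end{cases}$$
   Context: For a sequence $S=(s_i)_{i\ge0}$ with entries in $\mathbb{Z}_k$ write $\mathbf{s}_n(i)=(s_i,\dots,s_{i+n-1})$; an $n$-tuple occurs in $S$ if it equals $\mathbf{s}_n(i)$ for some $i$. A $k$-ary $n$-window sequence is a periodic sequence over $\mathbb{Z}_k$, of period $m$ say, such that $\mathbf{s}_n(i)=\mathbf{s}_n(j)$ implies $i\equiv j\pmod m$. For $k\ge3$, $n\ge2$, an $\mathcal{NAS}_k(n)$ ($k$-ary Negative Avoiding Sequence of span $n$) is a $k$-ary $n$-window sequence $S$ such that whenever an $n$-tuple $\mathbf{a}=(a_0,\dots,a_{n-1})$ occurs in $S$, its negative $-\mathbf{a}=(-a_0,\dots,-a_{n-1})$ does not occur in $S$. *)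

(* Defs.v *)
From mathcomp Require Import all_boot all_order all_algebra.

Set Implicit Arguments.
Unset Strict Implicit.
Unset Printing Implicit Defensive.

(* 'Z_k is the ring of integers mod k only for k >= 2. *)

Definition window (k n : nat) (S : nat -> 'Z_k) (i : nat) : n.-tuple 'Z_k :=
  [tuple S (i + j) | j < n].

Definition occurs (k n : nat) (S : nat -> 'Z_k) (a : n.-tuple 'Z_k) : Prop :=
  exists i : nat, window n S i = a.

Definition neg_tuple (k n : nat) (a : n.-tuple 'Z_k) : n.-tuple 'Z_k :=
  [tuple (- tnth a j)%R | j < n].

Definition has_period (T : Type) (S : nat -> T) (m : nat) : Prop :=
  0 < m /\ forall i : nat, S (i + m) = S i.

(* Minimality of m is not required separately: the window condition forces it,
   since a period d of S gives window 0 = window d, hence m %| d. *)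
Definition window_sequence (k n : nat) (S : nat -> 'Z_k) (m : nat) : Prop :=
  has_period S m /\
  forall i j : nat, window n S i = window n S j -> i = j %[mod m].

Definition negative_avoiding_sequence
    (k n : nat) (S : nat -> 'Z_k) (m : nat) : Prop :=
  window_sequence n S m /\
  forall a : n.-tuple 'Z_k, occurs S a -> ~ occurs S (neg_tuple a).

(* Main.v *)
(* The m windows of S, their m negatives and the negation-invariant n-tuples
   are pairwise disjoint families, so 2m + f <= k^n, where f counts the
   invariant tuples. The zero tuple is invariant; for even k so are all 2^n
   tuples with entries in {0, k/2}. *)
Require Import Defs.
From mathcomp Require Import all_boot all_order all_algebra.

(** Injectivity enters twice: it gives [f @: A] the size of [A], and it turns a fixed point [f x]
    with [x] in [A] into a fixed point [x] in [A], which the avoidance excludes. *)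
Lemma card_avoiding_set (T : finType) (f : T -> T) (A : {set T}) :
  injective f -> {in A, forall x, f x \notin A} ->
  2 * #|A| + #|[set x | f x == x]| <= #|T|.
Proof.
move=> f_inj fA.
have dA : [disjoint A & f @: A].
  apply/pred0P => y /=; apply/negP => /andP[yA /imsetP[x xA def_y]].
  by move: (fA x xA); rewrite -def_y yA.
have dF : [disjoint A :|: f @: A & [set x | f x == x]].
  apply/pred0P => y /=; apply/negP; rewrite !inE => /andP[yA /eqP fy].
  have {}yA : y \in A.
    case/orP: yA => // /imsetP[x xA def_y].
    by rewrite def_y in fy *; rewrite (f_inj _ _ fy).
  by move: (fA y yA); rewrite fy yA.
have cA : #|A :|: f @: A| = 2 * #|A|.
  by rewrite cardsU disjoint_setI0 // cards0 subn0 card_imset // mul2n addnn.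
by rewrite -cA -cardsUI (disjoint_setI0 dF) cards0 addn0 max_card.
Qed.

Lemma neg_tuple_inj (k n : nat) : injective (@neg_tuple k n).
Proof.
move=> a b /(congr1 (@tnth _ _)) eq_ab; apply: eq_from_tnth => j.
by move: (congr1 (@^~ j) eq_ab); rewrite !tnth_mktuple => /GRing.oppr_inj.
Qed.

Lemma neg_tuple_fixed_gt0 (k n : nat) :
  0 < #|[set a : n.-tuple 'Z_k | neg_tuple a == a]|.
Proof.
apply/card_gt0P; exists [tuple 0%R | _ < n]; rewrite inE; apply/eqP.
by apply: eq_from_tnth => j; rewrite !tnth_mktuple GRing.oppr0.
Qed.

Lemma neg_tuple_fixed_even (k n : nat) : 1 < k -> ~~ odd k ->
  2 ^ n <= #|[set a : n.-tuple 'Z_k | neg_tuple a == a]|.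
Proof.
move=> k_gt1 k_even; pose h : 'Z_k := (k./2%:R)%R.
have k2 : k./2.*2 = k by rewrite even_halfK.
have hN : (- h = h)%R.
  (* Here [h + h] is the image of [k], which vanishes in ['Z_k]. *)
  by apply/esym/eqP; rewrite -GRing.addr_eq0 -GRing.natrD addnn k2 pchar_Zp.
have half_pos : 0 < k./2 by rewrite half_gt0.
have h0 : h != 0%R.
  (* As [0 < k./2 < k], reduction mod [k] leaves [k./2] unchanged. *)
  rewrite -val_eqE /= val_Zp_nat // modn_small -?lt0n //.
  by rewrite -[X in _ < X]k2 -addnn -addn1 leq_add2l.
pose g (b : n.-tuple bool) : n.-tuple 'Z_k :=
  [tuple if tnth b j then h else 0%R | j < n].
have g_inj : injective g.
  move=> b c /(congr1 (@tnth _ _)) eq_bc; apply: eq_from_tnth => j.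
  move: (congr1 (@^~ j) eq_bc); rewrite !tnth_mktuple.
  by case: (tnth b j) (tnth c j) => [] [] // /eqP; rewrite ?[0%R == h]eq_sym (negPf h0).
have <- : #|[set g b | b : n.-tuple bool]| = 2 ^ n.
  by rewrite card_imset // card_tuple card_bool.
apply/subset_leq_card/subsetP => _ /imsetP[b _ ->]; rewrite inE; apply/eqP.
apply: eq_from_tnth => j; rewrite !tnth_mktuple.
by case: ifP; rewrite ?hN ?GRing.oppr0.
Qed.

(* Both divisions by 2 are exact and both subtractions are nonnegative. *)
Theorem theorem4p1 (k n : nat) (hk : 3 <= k) (hn : 2 <= n)
    (S : nat -> 'Z_k) (m : nat) (hS : negative_avoiding_sequence n S m) :
  m <= (if odd k then (k ^ n - 1) %/ 2 else (k ^ n - 2 ^ n) %/ 2).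
Proof.
have k_gt1 : 1 < k by apply: ltnW.
case: hS => -[_ winP] avoid.
pose A := [set window n S i | i : 'I_m].
have cA : #|A| = m.
  (* Indices below [m] that are congruent mod [m] are equal, so the [m] windows of one period are
     distinct. *)
  rewrite card_imset ?card_ord // => i j /winP.
  by rewrite !modn_small // => /val_inj.
have cT : #|{: n.-tuple 'Z_k}| = k ^ n.
  by rewrite card_tuple card_ord Zp_cast.
have fA : {in A, forall a, neg_tuple a \notin A}.
  move=> _ /imsetP[i _ ->]; apply/negP => /imsetP[j _ eq_ij].
  by case: (avoid (window n S i)); [exists i | exists j].
have := card_avoiding_set _ _ _ (neg_tuple_inj k n) fA.
rewrite cA cT => le_kn.
(* Used with [c = 1] for odd [k] and [c = 2 ^ n] for even [k]. Since [2 * m + c <= k ^ n] forces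
   [c <= k ^ n], the subtraction does not truncate and [c] can be added back. *)
have le_half c : c <= #|[set a : n.-tuple 'Z_k | neg_tuple a == a]| ->
    m <= (k ^ n - c) %/ 2.
  move=> le_c; rewrite leq_divRL // mulnC -(leq_add2r c).
  have le_sum : 2 * m + c <= k ^ n by apply: leq_trans le_kn; rewrite leq_add2l.
  by rewrite subnK // (leq_trans (leq_addl _ _) le_sum).
case: ifP => [_ | /negbT k_even]; apply: le_half.
  exact: neg_tuple_fixed_gt0.
exact: neg_tuple_fixed_even.
Qed.
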